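(* Let $n \geq 2$ and let $I = \{i_1 < \cdots < i_k\} \subset [n-1]$ be such that for some $1 \leq s \leq k$, \[ i_1, \ldots, i_{k-s+1} \leq n-k, \qquad i_{k-s+\ell} = n-s+\ell-1 \text{ for } 2 \leq \ell \leq s \] (i.e. $i_{k-s+2} = n-s+1, \ldots, i_k = n-1$). Let $0 \leq u \leq s$. Then \[ \sum_J (-1)^d\, \Delta_s(j_{k-s+1}, \ldots, j_k) \binom{d+u}{u}\, \partial_{e_{n-s-d}(x_1, \ldots, x_{n-s+u})}\, \mathrm{d}_{j_1} \cdots \mathrm{d}_{j_k} \Delta_n = 0, \] where the sum is over all subsets $J = \{j_1 < \cdots < j_k\} \subset [n-1]$ with $j_1 = i_1, \ldots, j_{k-s} = i_{k-s}$ and $d = (j_{k-s+1} - i_{k-s+1}) + \cdots + (j_k - i_k) \geq 0$.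
   Context: Work in $\mathbb{Q}[x_1, \ldots, x_n, \theta_1, \ldots, \theta_n]$ where the $x_i$ commute, the $\theta_i$ anticommute, and $x_i$ commutes with $\theta_j$. $\Delta_n = \prod_{1 \leq i < j \leq n}(x_j - x_i)$ and, for numbers $y_1, \ldots, y_s$, $\Delta_s(y_1, \ldots, y_s) = \prod_{1 \leq v < w \leq s}(y_w - y_v)$. For a polynomial $g \in \mathbb{Q}[x_1, \ldots, x_n]$, $\partial_g$ is obtained by substituting $\partial_{x_i}$ for $x_i$. For $i \geq 1$, $\mathrm{d}_i \omega = \sum_{j=1}^n \theta_j\, \partial_{x_j}^i \omega$. $e_r(x_1, \ldots, x_m)$ is the elementary symmetric polynomial, with $e_0 = 1$ and $e_r = 0$ for $r < 0$ or $r > m$. *)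

(* Defs.v *)
From HB Require Import structures.
From mathcomp Require Import all_boot all_order all_algebra.
From mathcomp Require Import mpoly.
Set Implicit Arguments. Unset Strict Implicit. Unset Printing Implicit Defensive.
Import Order.TTheory GRing.Theory Num.Theory.
Local Open Scope ring_scope.

(* Variable x_i (1 <= i <= n) is 'X_(i-1), theta_i is indexed by the ordinal i-1. *)

(* Superspace Q[x_1..x_n, theta_1..theta_n]: an element is the family of its
   coefficients on the basis theta_S = theta_{s_1} ... theta_{s_m}
   (s_1 < ... < s_m, S = {s_1,...,s_m}). *)
Definition superspace (n : nat) := {ffun {set 'I_n} -> {mpoly rat[n]}}.

Definition theta_mul n (j : 'I_n) (w : superspace n) : superspace n :=
  [ffun S : {set 'I_n} => if j \in S then
      (-1) ^+ #|[set t in S | (t < j)%N]| *: w (S :\ j) else 0].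

Definition pdx n (j : 'I_n) (w : superspace n) : superspace n :=
  [ffun S => mderiv j (w S)].

Definition dop n (i : nat) (w : superspace n) : superspace n :=
  \sum_(j < n) theta_mul j (iter i (pdx j) w).

Definition pdpoly n (g : {mpoly rat[n]}) (w : superspace n) : superspace n :=
  [ffun S => \sum_(m <- msupp g) g@_m *: mderivm m (w S)].

Definition even_part n (p : {mpoly rat[n]}) : superspace n :=
  [ffun S => if S == set0 then p else 0].

Definition Delta_poly n : {mpoly rat[n]} :=
  \prod_(i < n) \prod_(j < n | (i < j)%N) ('X_j - 'X_i).

Definition Delta_num (y : seq nat) : rat :=
  \prod_(w < size y) \prod_(v < size y | (v < w)%N)
     ((nth 0%N y w)%:R - (nth 0%N y v)%:R).

Definition esym_first n (m : nat) (r : int) : {mpoly rat[n]} :=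
  match r with
  | Posz r' => \sum_(S : {set 'I_n} | (#|S| == r') && [forall i in S, (val i < m)%N])
                  \prod_(i in S) 'X_i
  | Negz _ => 0
  end.

(* the elements of J (a subset of {0..n-1}, shifted: ordinal j stands for j+1)
   listed increasingly, as natural numbers in [n] *)
Definition sorted_elems n (J : {set 'I_n}) : seq nat :=
  sort leq [seq (val j).+1 | j in J].

Definition dops n (js : seq nat) (w : superspace n) : superspace n :=
  foldr (fun j v => dop j v) w js.

(* Main.v *)
(** Let [A] be the ideal of the polynomials [g] with [g(d/dx) Delta_n = 0], let [xi_b] be the
    class of [x_b] modulo [A], and put [G_b(q) = sum_(j < n) (xi_b q)^j].  Two relations suffice:
    [prod_b (1 - xi_b q) = 1], and a monomial in [m] of the [xi_b] vanishes as soon as its degree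
    exceeds [(n-1) + ... + (n-m)], because [Delta_n] has that degree in any [m] of its variables.
    In particular [xi_b^n = 0], so that [G_b] is the inverse of [1 - xi_b q].

    The coefficient of a theta-monomial in [d_{j_1} ... d_{j_k} Delta_n] is a determinant
    [det (x_t^{j_l})] applied to [Delta_n].  The factor [Delta_s] is also a determinant, in the
    basis [j |-> (j + c)^_c], and expanding it turns the sum over the subsets [J] into a sum over
    all [s]-tuples of exponents below [n].  Expanding the other determinant, one is left, for
    distinct [b_0, ..., b_(s-1)], with the coefficients of
    [G_(b_0) G_(b_1)^2 ... G_(b_(s-1))^s] multiplied by elementary symmetric polynomials in
    [Z = {x_1, ..., x_(n-s+u)}].  Since ['C(d + u, u) e_(n-s-d)(Z)] is the sum of the
    [e_(n-s-d)(Y)] over the [Y] in [Z] with [#|Y| = n - s], the total is, up to sign, a sum over [Y]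
    of coefficients of [prod_(y in Y) (1 - xi_y q) * prod_l G_(b_l)^(l+1)], of degree
    [(n-1) + ... + (n-s) + i_(k-s+1)].  That product has degree at most [(n-1) + ... + (n-s)]
    in [q]: either [Y] is the complement of the [b_l], and the product is a series in the [s]
    classes [xi_(b_l)] only, or some [b_p] lies in [Y] and its factor cancels. *)

Require Import Defs.
From HB Require Import structures.
From mathcomp Require Import all_boot all_order all_algebra.
From mathcomp Require Import all_fingroup.
From mathcomp Require Import mpoly ring_quotient.
From mathcomp Require Import zify ring.
Set Implicit Arguments. Unset Strict Implicit. Unset Printing Implicit Defensive.
Import Order.TTheory GRing.Theory Num.Theory.
Local Open Scope ring_scope.

(** * The coinvariant relations and the degree bound *)

(** For [m <= n], the largest sum of [m] distinct naturals below [n], hence the degree of the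
    Vandermonde product in any [m] of its variables. *)
Definition stair (n m : nat) : nat := (\sum_(i < m) (n.-1 - i))%N.

Definition lin (Q : comNzRingType) (x : Q) : {poly Q} := 1 - x *: 'X.

Definition geo (Q : comNzRingType) (n : nat) (x : Q) : {poly Q} := \poly_(j < n) x ^+ j.

Lemma coef_lin_mul (Q : comNzRingType) (x : Q) (p : {poly Q}) j :
  (lin x * p)`_j = p`_j - x * (if j is j'.+1 then p`_j' else 0).
Proof.
by rewrite /lin mulrBl mul1r -scalerAl coefB coefZ coefXM; case: j.
Qed.

Lemma size_lin (Q : comNzRingType) (x : Q) : (size (lin x) <= 2)%N.
Proof.
apply/leq_sizeP => j; case: j => [|[|j]] // _.
by rewrite /lin coefB coef1 coefZ coefX /= mulr0 subr0.
Qed.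

Section TruncatedGeometricSeries.
Variables (Q : comNzRingType) (n : nat) (x : Q).
Hypothesis xn0 : x ^+ n = 0.

Lemma nilp_exp_gt0 : (0 < n)%N.
Proof.
by rewrite lt0n; apply/eqP => n0; move: xn0; rewrite n0 expr0; apply/eqP/oner_neq0.
Qed.

Lemma lin_geo : lin x * geo n x = 1.
Proof.
apply/polyP => j; rewrite coef_lin_mul coef1 !coef_poly.
case: j => [|j].
  by rewrite mulr0 subr0 expr0 nilp_exp_gt0.
rewrite coef_poly; case: ltnP => jn; first by rewrite ltnW // -exprS subrr.
case: ltnP => jn'; last by rewrite mulr0 subrr.
by rewrite -exprS /= (_ : j.+1 = n) ?xn0 ?subrr //; lia.
Qed.

(** Induction on [c]: multiplying by [lin x] undoes one factor, by Pascal's rule in degrees below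
    [n] and by [xn0] in degree [n]. The predecessor is correct at [c = 0], where ['C(j.-1, j)] is
    [1] for [j = 0] and [0] otherwise. *)
Lemma geo_exp c :
  geo n x ^+ c = \poly_(j < n) ('C((j + c).-1, j)%:R * x ^+ j).
Proof.
elim: c => [|c IHc].
  apply/polyP => j; rewrite expr0 coef1 coef_poly.
  case: j => [|j]; last by rewrite addn0 /= bin_small // mul0r if_same.
  by rewrite nilp_exp_gt0 bin0 mul1r expr0.
rewrite exprS IHc -[RHS]mul1r -lin_geo [lin x * _]mulrC -mulrA; congr (_ * _).
apply/polyP => j; rewrite coef_lin_mul !coef_poly addnS /=.
case: j => [|j].
  by rewrite mulr0 subr0 !bin0.
rewrite coef_poly; case: ltnP => jn.
  rewrite ltnW // mulrCA -exprS -mulrBl -natrB; last first.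
    by rewrite addSn addnS /= binS leq_addl.
  by rewrite addSn addnS /= binS addnK.
case: ltnP => jn'; last by rewrite mulr0 subrr.
by rewrite mulrCA -exprS (_ : j.+1 = n) ?xn0 ?mulr0 ?subrr //; lia.
Qed.

End TruncatedGeometricSeries.

Section CoinvariantRelations.
Variables (Q : comNzRingType) (n : nat) (xi : 'I_n -> Q).
Hypothesis prod_lin1 : \prod_i lin (xi i) = 1.
Hypothesis high_deg0 : forall (W : {set 'I_n}) (mu : 'I_n -> nat),
  (stair n #|W| < \sum_(b in W) mu b)%N -> \prod_(b in W) xi b ^+ mu b = 0.

Lemma xi_nilp b : xi b ^+ n = 0.
Proof.
have n0 : (0 < n)%N by case: n b => // -[].
have := @high_deg0 [set b] (fun=> n); rewrite !big_set1; apply.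
by rewrite cards1 /stair big_ord1; lia.
Qed.

Lemma prod_geo_expand (J : finType) (x : J -> Q) (e : J -> nat) :
  (forall l, x l ^+ n = 0) ->
  \prod_l geo n (x l) ^+ e l =
  \sum_(f : {ffun J -> 'I_n})
    (\prod_l ('C((f l + e l).-1, f l)%:R * x l ^+ f l)) *: 'X^(\sum_l f l).
Proof.
move=> xn.
under eq_bigr => l _ do rewrite (geo_exp (xn l)) poly_def.
rewrite bigA_distr_bigA; apply: eq_bigr => f _.
by rewrite scaler_prod prodrXr.
Qed.

Lemma size_prod_geo (W : {set 'I_n}) (e : 'I_n -> nat) :
  (size (\prod_(b in W) geo n (xi b) ^+ e b)%R <= (stair n #|W|).+1)%N.
Proof.
(* With exponent [0] outside [W] the expansion can run over all indices. A term with [f b > 0] for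
   such a [b] carries the factor ['C((f b).-1, f b) = 0]; the others are monomials over [W], and
   [high_deg0] bounds their degree. *)
pose e' b := if b \in W then e b else 0%N.
have -> : \prod_(b in W) geo n (xi b) ^+ e b = \prod_b geo n (xi b) ^+ e' b.
  rewrite big_mkcond; apply: eq_bigr => b _; rewrite /e'.
  by case: ifP => //; rewrite expr0.
rewrite prod_geo_expand; last exact: xi_nilp.
apply: (leq_trans (size_sum _ _ _)); apply/bigmax_leqP => f _.
have [/forallP fW|] := boolP [forall b, (b \notin W) ==> (f b == 0%N :> nat)]; last first.
  rewrite negb_forall => /existsP[b]; rewrite negb_imply => /andP[bW fb].
  rewrite (bigD1 b) //= /e' (negbTE bW) addn0 bin_small ?mul0r ?mul0r ?scale0r ?size_poly0 //.
  by rewrite ltn_predL lt0n.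
have fW0 b : b \notin W -> f b = 0%N :> nat by move/(implyP (fW b))/eqP.
have -> : (\sum_l f l = \sum_(l in W) f l)%N.
  rewrite [RHS]big_mkcond; apply: eq_bigr => l _; case: ifP => // /negbT; exact: fW0.
rewrite big_split /=.
have -> : \prod_b xi b ^+ f b = \prod_(b in W) xi b ^+ f b.
  rewrite [RHS]big_mkcond; apply: eq_bigr => l _; case: ifP => // /negbT /fW0 ->.
  by rewrite expr0.
case: (ltnP (stair n #|W|) (\sum_(l in W) f l)) => [h|h].
  by rewrite high_deg0 // mulr0 scale0r size_poly0.
by apply: (leq_trans (size_scale_leq _ _)); rewrite size_polyXn.
Qed.

(** Both sides invert the product of the [lin (xi b)] over [W], because all the [lin (xi i)]
    multiply to [1]. The degree is thus at most [n - #|W|]. *)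
Lemma prod_geo_compl (W : {set 'I_n}) :
  \prod_(b in W) geo n (xi b) = \prod_(b in ~: W) lin (xi b).
Proof.
transitivity ((\prod_i lin (xi i)) * \prod_(b in W) geo n (xi b)).
  by rewrite prod_lin1 mul1r.
rewrite [X in X * _](bigID (mem W)) /= mulrAC -big_split /=.
rewrite [X in X * _]big1 ?mul1r => [|b _]; last by rewrite lin_geo // xi_nilp.
by apply: eq_bigl => b; rewrite inE.
Qed.

Lemma size_prod_lin (W : {set 'I_n}) : (size (\prod_(b in W) lin (xi b))%R <= #|W|.+1)%N.
Proof.
rewrite -sum1_card; elim/big_rec2: _ => [|b m p _ IH]; first by rewrite size_poly1.
apply: (leq_trans (size_polyMleq _ _)).
by have := size_lin (xi b); move: IH; lia.
Qed.

Lemma size_mul_bound (p q : {poly Q}) a b :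
  (size p <= a.+1)%N -> (size q <= b.+1)%N -> (size (p * q)%R <= (a + b).+1)%N.
Proof. by move=> hp hq; apply: (leq_trans (size_polyMleq _ _)); lia. Qed.

Lemma size_prod_bound m (F : 'I_m -> {poly Q}) (d : 'I_m -> nat) :
  (forall i, size (F i) <= (d i).+1)%N ->
  (size (\prod_i F i)%R <= (\sum_i d i).+1)%N.
Proof.
move=> h; elim/big_rec2: _ => [|i a p _ IH]; first by rewrite size_poly1.
exact: size_mul_bound.
Qed.

(** The [p + 1] smallest terms of [stair n s] are [n - s, ..., n - s + p]. *)
Lemma stair_split s p : (s <= n)%N -> (p < s)%N ->
  stair n s = (stair n (s - p.+1) + \sum_(k < p.+1) (n - s + k))%N.
Proof.
move=> sn ps; rewrite /stair -!(big_mkord xpredT (fun i => n.-1 - i)%N).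
rewrite (big_cat_nat (n := s - p.+1)%N) ?leq_subr //=; congr (_ + _)%N.
rewrite -{1}[(s - p.+1)%N]add0n big_addn (_ : s - (s - p.+1) = p.+1)%N; last by lia.
rewrite big_mkord (reindex_inj rev_ord_inj) /=; apply: eq_bigr => k _.
have := ltn_ord k; lia.
Qed.

Lemma size_core (s : nat) (beta : 'I_s -> 'I_n) (Y : {set 'I_n}) :
  injective beta -> (s <= n)%N -> #|Y| = (n - s)%N ->
  (size ((\prod_(y in Y) lin (xi y)) * \prod_l geo n (xi (beta l)) ^+ l.+1)%R
     <= (stair n s).+1)%N.
Proof.
move=> binj sn cY.
have [/existsP[p pY]|] := boolP [exists p, beta p \in Y]; last first.
  rewrite negb_exists => /forallP disj.
  set S := [set beta l | l : 'I_s].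
  have cS : #|S| = s by rewrite card_imset // card_ord.
  have -> : Y = ~: S.
    apply/eqP; rewrite eqEcard cardsCs setCK cS card_ord cY leqnn andbT.
    apply/subsetP => y yY; rewrite inE; apply/imsetP => -[l _ yl].
    by have := disj l; rewrite -yl yY.
  rewrite -prod_geo_compl big_imset /=; last by move=> ? ? _ _; exact: binj.
  rewrite -big_split /=.
  (* Rewriting the [lin] factors over the complement as one more [geo] factor for each [beta l]
     raises the exponent from [l + 1] to [l + 2]. *)
  pose e (b : 'I_n) := (if [pick l | beta l == b] is Some l then l.+2 else 0)%N.
  have := size_prod_geo S e; rewrite cS big_imset /=; last by move=> ? ? _ _; exact: binj.
  congr (size (polyseq _) <= _)%N; apply: eq_bigr => l _; rewrite -exprS /e.
  by case: pickP => [l' /eqP/binj ->|/(_ l)]; rewrite ?eqxx.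
pose W (k : nat) := [set beta l | l : 'I_s & (k <= l)%N].
have bij k (F : 'I_n -> {poly Q}) :
    \prod_(b in W k) F b = \prod_(l < s | (k <= l)%N) F (beta l).
  rewrite big_imset /=; last by move=> ? ? _ _; exact: binj.
  by apply: eq_bigl => l; rewrite inE.
have cW k : (k <= s)%N -> #|W k| = (s - k)%N.
  move=> ks; rewrite card_imset //.
  rewrite -[in RHS](card_ord s) -(cardsC [set l : 'I_s | (k <= l)%N]).
  suff -> : #|~: [set l : 'I_s | (k <= l)%N]| = k by rewrite addnK.
  have -> : ~: [set l : 'I_s | (k <= l)%N] = [set widen_ord ks i | i : 'I_k].
    apply/setP => l; rewrite !inE -ltnNge; apply/idP/imsetP => [lk|[i _ ->] //=].
    by exists (Ordinal lk) => //; apply: val_inj.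
  by rewrite card_imset ?card_ord // => i j /(congr1 val) /= /val_inj.
rewrite (big_setD1 (beta p)) //= (bigD1 p) //=.
(* [1 - xi_(b_p) q] cancels one [G_(b_p)]; what remains of [prod_l G_(b_l)^(l+1)] is split
   into the [W k]-products, [k < p], which are polynomials of degree [n - #|W k|] by
   [prod_geo_compl], and a series in the classes [xi_(b_l)], [l > p], only. *)
have -> : (\prod_(l < s | l != p) geo n (xi (beta l)) ^+ l.+1) =
    (\prod_(l < s | l != p) geo n (xi (beta l)) ^+ minn l.+1 p) *
    (\prod_(l < s | (p < l)%N) geo n (xi (beta l)) ^+ (l.+1 - p)).
  rewrite [X in _ * X]big_mkcond [X in _ * X](bigD1 p) //= ltnn mul1r -big_split /=.
  apply: eq_bigr => l lp; case: ltnP => pl; last first.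
    by rewrite mulr1; congr (_ ^+ _); move: pl lp; rewrite -val_eqE /=; lia.
  by rewrite -exprD; congr (_ ^+ _); lia.
rewrite exprS.
set A := \prod_(i in Y :\ beta p) _; set g := geo n _; set B := \prod_(l < s | _) _.
set C := \prod_(l < s | _) _.
have -> : lin (xi (beta p)) * A * (g * g ^+ p * (B * C)) = A * ((g ^+ p * B) * C).
  transitivity ((lin (xi (beta p)) * g) * (A * ((g ^+ p * B) * C))); first by ring.
  by rewrite lin_geo ?mul1r //; exact: xi_nilp.
(* [beta l] lies in [W k] for exactly [minn l.+1 p] of the indices [k < p]. *)
have -> : g ^+ p * B = \prod_(k < p) \prod_(b in W k) geo n (xi b).
  transitivity (\prod_(l < s) geo n (xi (beta l)) ^+ minn l.+1 p).
    by rewrite [RHS](bigD1 p) //= (_ : minn p.+1 p = p) //; lia.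
  under [RHS]eq_bigr => k _ do rewrite bij big_mkcond.
  rewrite exchange_big /=; apply: eq_bigr => l _.
  rewrite -big_mkcond /= prodr_const; congr (_ ^+ _).
  have lep : (minn l.+1 p <= p)%N by lia.
  transitivity #|[set widen_ord lep i | i : 'I_(minn l.+1 p)]|.
    by rewrite card_imset ?card_ord // => i j /(congr1 val) /= /val_inj.
  apply: eq_card => k; rewrite [RHS]unfold_in; apply/imsetP/idP => [[i _ ->] /=|kl].
    by have := ltn_ord i; lia.
  have kl' : (k < minn l.+1 p)%N by have := ltn_ord k; lia.
  by exists (Ordinal kl') => //; apply: val_inj.
have hA : (size A <= (n - s).-1.+1)%N.
  have := size_prod_lin (Y :\ beta p).
  by rewrite -cY (cardsD1 (beta p) Y) pY.
have hB : (size (\prod_(k < p) \prod_(b in W k) geo n (xi b))%R <= (\sum_(k < p) (n - s + k)).+1)%N.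
  apply: size_prod_bound => k; rewrite prod_geo_compl.
  apply: (leq_trans (size_prod_lin _)).
  have [kp ps] := (ltn_ord k, ltn_ord p).
  rewrite cardsCs setCK card_ord cW; lia.
have hC : (size C <= (stair n (s - p.+1)).+1)%N.
  have := size_prod_geo (W p.+1) (fun b => if [pick l | beta l == b] is Some l then (l.+1 - p)%N else 0%N).
  rewrite cW // bij; congr (size (polyseq _) <= _)%N; apply: eq_bigr => l _.
  by case: pickP => [l' /eqP/binj ->|/(_ l)]; rewrite ?eqxx.
(* In [stair_split] the term [n - s + p] stands against the bound [n - s - 1] for [A], so the degree
   even stays [p + 1] below [stair n s]. *)
apply: leq_trans (size_mul_bound hA (size_mul_bound hB hC)) _.
have /stair_split -> // := ltn_ord p.
rewrite big_ord_recr /= ltnS; lia.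
Qed.

End CoinvariantRelations.

(** * Elementary symmetric sums over subsets, and the vanishing sum over tuples of exponents *)

Section SymmetricSums.
Variables (Q : comNzRingType) (n : nat) (xi : 'I_n -> Q).

Definition esym_on (Z : {set 'I_n}) (r : nat) : Q :=
  \sum_(S : {set 'I_n} | (#|S| == r) && (S \subset Z)) \prod_(i in S) xi i.

Lemma coef_prod_lin (Y : {set 'I_n}) r :
  (\prod_(y in Y) lin (xi y))`_r = (-1) ^+ r * esym_on Y r.
Proof.
have -> : \prod_(y in Y) lin (xi y) =
    \prod_y ((if y \in Y then - xi y else 0) *: 'X + 1).
  rewrite big_mkcond; apply: eq_bigr => y _.
  by case: ifP => _; rewrite ?scale0r ?add0r // scaleNr addrC.
rewrite bigA_distr /= coef_sum /esym_on mulr_sumr [RHS]big_mkcond /=.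
apply: eq_bigr => S _.
rewrite (bigID (mem S)) /= [X in _ * X]big1 ?mulr1 => [|i /negbTE ->] //.
rewrite (eq_bigr (fun i => (if i \in Y then - xi i else 0) *: 'X)) => [|i ->] //.
rewrite scaler_prod prodr_const coefZ coefXn eq_sym.
have [cS|] := eqVneq #|S| r; last by rewrite mulr0.
rewrite mulr1 /=; case: (boolP (S \subset Y)) => [/subsetP SY|].
  rewrite -{}cS (eq_bigr (fun i => - xi i)) => [|i /SY -> //].
  by rewrite prodrN.
case/subsetPn => i iS iY.
by rewrite (bigD1 i) //= (negbTE iY) mul0r.
Qed.

Lemma card_between (S Z : {set 'I_n}) m :
  S \subset Z ->
  #|[set Y : {set 'I_n} | [&& Y \subset Z, #|Y| == (#|S| + m)%N & S \subset Y]]| =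
  'C(#|Z| - #|S|, m).
Proof.
move=> SZ; rewrite -(cardsDS SZ) -cards_draws.
have inj : {in [set A : {set 'I_n} | A \subset Z :\: S & #|A| == m] &,
    injective (fun A => S :|: A)}.
  move=> A B; rewrite !inE !subsetD => /andP[/andP[_ dA] _] /andP[/andP[_ dB] _] AB.
  have e (C : {set 'I_n}) : [disjoint C & S] -> (S :|: C) :\: S = C.
    by move=> dC; rewrite setDUl setDv set0U; apply/setDidPl.
  by rewrite -(e A dA) -(e B dB) AB.
rewrite -(card_in_imset inj); apply: eq_card => Y; rewrite !inE.
apply/idP/imsetP => [/and3P[YZ /eqP cY SY]|[A]].
  exists (Y :\: S); last by rewrite setDE setUIr setUCr setIT; apply/esym/setUidPr.
  by rewrite inE setSD //= cardsDS // cY addKn.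
rewrite inE subsetD => /andP[/andP[AZ dA] /eqP <-] ->.
rewrite subUset SZ AZ subsetUl andbT /= cardsU.
by rewrite setIC (disjoint_setI0 dA) cards0 subn0 eqxx.
Qed.

(** Double counting: a set [S] of size [r] in [Z] lies in ['C(#|Z| - r, m - r)] of the [Y]. For
    [m = n - s], [r = n - s - d] and [#|Z| = n - s + u] this is the binomial ['C(d + u, u)]. *)
Lemma sum_esym_on (Z : {set 'I_n}) m r : (r <= m)%N ->
  \sum_(Y : {set 'I_n} | (Y \subset Z) && (#|Y| == m)) esym_on Y r =
  'C(#|Z| - r, m - r)%:R * esym_on Z r.
Proof.
move=> rm; rewrite /esym_on mulr_sumr.
rewrite (exchange_big_dep (fun S : {set 'I_n} => (#|S| == r) && (S \subset Z))) /=; last first.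
  by move=> Y S /andP[YZ _] /andP[-> SY]; rewrite (subset_trans SY YZ).
apply: eq_bigr => S /andP[/eqP cS SZ].
rewrite sumr_const mulr_natl; congr (_ *+ _).
have := card_between (m - r) SZ; rewrite cS => <-; apply: eq_card => Y.
by rewrite unfold_in /= !inE ?cS eqxx /= subnKC // -andbA.
Qed.

Hypothesis prod_lin1 : \prod_i lin (xi i) = 1.
Hypothesis high_deg0 : forall (W : {set 'I_n}) (mu : 'I_n -> nat),
  (stair n #|W| < \sum_(b in W) mu b)%N -> \prod_(b in W) xi b ^+ mu b = 0.

(** Up to sign this adds, over the [Y] in [Z] with [n - s] elements, the coefficients of degree
    [M + (n - s)] of the product in [size_core]. By [a > 0] that degree exceeds [stair n s]. *)
Lemma vanishing_sum s u a M (beta : 'I_s -> 'I_n) (Z : {set 'I_n}) :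
  injective beta -> (s <= n)%N -> #|Z| = (n - s + u)%N -> (0 < a)%N ->
  (M + (n - s) = stair n s + a)%N ->
  \sum_(f : {ffun 'I_s -> 'I_n} | (M <= \sum_l f l <= M + (n - s))%N)
     (-1) ^+ (\sum_l f l - M) * 'C(\sum_l f l - M + u, u)%:R
       * esym_on Z (n - s - (\sum_l f l - M))
       * \prod_l ('C(f l + l, f l)%:R * xi (beta l) ^+ f l) = 0.
Proof.
move=> binj sn cZ a0 hM.
pose p : {poly Q} := \prod_l geo n (xi (beta l)) ^+ l.+1.
pose F (f : {ffun 'I_s -> 'I_n}) :=
  \prod_l ('C(f l + l, f l)%:R * xi (beta l) ^+ f l) : Q.
have pE : p = \sum_(f : {ffun 'I_s -> 'I_n}) F f *: 'X^(\sum_l f l).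
  rewrite /p prod_geo_expand => [|l]; last exact: (xi_nilp high_deg0).
  apply: eq_bigr => f _; congr (_ *: _); apply: eq_bigr => l _.
  by rewrite addnS.
have pm m : p`_m = \sum_(f : {ffun 'I_s -> 'I_n} | (\sum_l f l)%N == m) F f.
  rewrite pE coef_sum [RHS]big_mkcond; apply: eq_bigr => f _.
  by rewrite coefZ coefXn eq_sym; case: eqP; rewrite ?mulr1 ?mulr0.
rewrite (partition_big (fun f : {ffun 'I_s -> 'I_n} => inord (\sum_l f l - M) : 'I_(n - s).+1)
   xpredT) //=.
transitivity (\sum_(d < (n - s).+1) \sum_(Y : {set 'I_n} | (Y \subset Z) && (#|Y| == (n - s)%N))
    (-1) ^+ d * esym_on Y (n - s - d) * p`_(M + d)).
  apply: eq_bigr => d _.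
  have dn : (d <= n - s)%N by rewrite -ltnS.
  rewrite -mulr_suml -mulr_sumr sum_esym_on ?leq_subr // cZ subKn //.
  rewrite (_ : n - s + u - (n - s - d) = d + u)%N; last by lia.
  rewrite (_ : 'C(d + u, d) = 'C(d + u, u)); last first.
    by rewrite -[RHS](bin_sub (leq_addl d u)) addnK.
  rewrite pm mulr_sumr; apply: eq_big => [f|f].
    apply/andP/eqP => [[/andP[h1 h2] /eqP e]|e].
      by move: (congr1 val e); rewrite /= inordK; lia.
    split; first by rewrite e; lia.
    by apply/eqP; apply: val_inj; rewrite /= inordK e; lia.
  move=> /andP[/andP[h1 h2] /eqP e].
  have -> : (\sum_l f l - M = d)%N by move: (congr1 val e); rewrite /= inordK; lia.
  by rewrite !mulrA.
rewrite exchange_big big1 //= => Y /andP[YZ /eqP cY].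
have := size_core prod_lin1 high_deg0 binj sn cY.
rewrite -/p; set A := \prod_(y in Y) _ => hs.
have hA : (size A <= (n - s).+1)%N by rewrite -cY; exact: size_prod_lin.
have Ap0 : (A * p)`_(M + (n - s)) = 0 by apply: (leq_sizeP _ _ hs); lia.
have S0 : \sum_(i < (n - s).+1) A`_i * p`_(M + (n - s) - i) = 0.
  rewrite (big_ord_widen (M + (n - s)).+1 (fun i => A`_i * p`_(M + (n - s) - i))); last by lia.
  rewrite big_mkcond -[RHS]Ap0 coefM; apply: eq_bigr => i _.
  by case: ltnP => // h; rewrite (leq_sizeP _ _ hA) ?mul0r.
(* With [d = n - s - i], the sum over [d] is [(-1) ^+ (n - s)] times the Cauchy product in [S0]. *)
rewrite (reindex_inj rev_ord_inj) /= -[RHS](mulr0 ((-1) ^+ (n - s))) -[in RHS]S0 mulr_sumr.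
apply: eq_bigr => i _.
have iN : (i <= n - s)%N by rewrite -ltnS.
rewrite subSS subKn // coef_prod_lin -addnBA // !mulrA -exprD.
by rewrite -signr_odd -[in RHS]signr_odd oddB ?oddD.
Qed.
End SymmetricSums.

(** * Polynomials acting as differential operators on the Vandermonde product *)

Section DifferentialAction.
Variable n : nat.
Implicit Types (g h p : {mpoly rat[n]}).

(** The action of [pdpoly g] on a single theta-coefficient. *)
Definition dact g p : {mpoly rat[n]} := \sum_(m <- msupp g) g@_m *: p^`M[m].

Lemma dactwE (s : seq 'X_{1..n}) g p : uniq s -> {subset msupp g <= s} ->
  dact g p = \sum_(m <- s) g@_m *: p^`M[m].
Proof.
move=> us gs; rewrite /dact [RHS](bigID (mem (msupp g))) /= [X in _ + X]big1 => [|m]; last first.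
  by move/memN_msupp_eq0 ->; rewrite scale0r.
rewrite addr0 -[RHS]big_filter; apply/perm_big/uniq_perm => //; first exact: filter_uniq.
by move=> m; rewrite mem_filter; case: (boolP (m \in msupp g)) => [/gs ->|].
Qed.

Lemma dact_linear p : linear (dact^~ p).
Proof.
move=> c g h; pose s := undup (msupp g ++ msupp h).
have us : uniq s by exact: undup_uniq.
rewrite !(@dactwE s) // => [|m mh|m mg|m].
- rewrite scaler_sumr -big_split; apply: eq_bigr => m _ /=.
  by rewrite mcoeffD mcoeffZ scalerDl scalerA.
- by rewrite mem_undup mem_cat mh orbT.
- by rewrite mem_undup mem_cat mg.
- rewrite mem_undup => /msuppD_le; rewrite !mem_cat.
  by case/orP => [/msuppZ_le ->|->]; rewrite ?orbT.
Qed.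

Lemma dactD p g h : dact (g + h) p = dact g p + dact h p.
Proof. by have := dact_linear p 1 g h; rewrite !scale1r. Qed.

Lemma dact0 p : dact 0 p = 0.
Proof. by apply: (addrI (dact 0 p)); rewrite -dactD !addr0. Qed.

Lemma dactZ p c g : dact (c *: g) p = c *: dact g p.
Proof. by have := dact_linear p c g 0; rewrite dact0 !addr0. Qed.

Lemma dact_sum p (J : Type) (r : seq J) (P : pred J) (F : J -> {mpoly rat[n]}) :
  dact (\sum_(j <- r | P j) F j) p = \sum_(j <- r | P j) dact (F j) p.
Proof. by apply: (big_morph (dact^~ p)); [exact: dactD | exact: dact0]. Qed.

Lemma dact_sumr g (J : Type) (r : seq J) (P : pred J) (F : J -> {mpoly rat[n]}) :
  dact g (\sum_(j <- r | P j) F j) = \sum_(j <- r | P j) dact g (F j).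
Proof.
rewrite /dact exchange_big; apply: eq_bigr => m _ /=.
by rewrite linear_sum scaler_sumr.
Qed.

Lemma dactZr c g p : dact g (c *: p) = c *: dact g p.
Proof.
rewrite /dact scaler_sumr; apply: eq_bigr => m _.
by rewrite mderivmZ !scalerA mulrC.
Qed.

Lemma dact0r g : dact g 0 = 0.
Proof. by have := dactZr 0 g 0; rewrite !scale0r. Qed.

Lemma dactX m p : dact 'X_[m] p = p^`M[m].
Proof. by rewrite /dact msuppX big_seq1 mcoeffX eqxx scale1r. Qed.

Lemma dact1 p : dact 1 p = p.
Proof. by rewrite -mpolyX0 dactX mderivm0m. Qed.

Lemma dactM g h p : dact (g * h) p = dact g (dact h p).
Proof.
rewrite [g in LHS]mpolyE [in RHS]/dact mulr_suml dact_sum; apply: eq_bigr => m _.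
rewrite -scalerAl dactZ; congr (_ *: _).
rewrite [h in LHS]mpolyE /dact -/(dact _ _) mulr_sumr dact_sum linear_sum.
apply: eq_bigr => m' _ /=.
by rewrite -scalerAr dactZ -mpolyXD dactX addmC mderivmDm mderivmZ.
Qed.

Definition perm_mnm (s : 'S_n) : 'X_{1..n} := [multinom (s i : nat) | i < n].

Lemma Delta_polyE :
  Delta_poly n = \sum_(s : 'S_n) (-1) ^+ s *: 'X_[perm_mnm s].
Proof.
have := det_Vandermonde (\row_(i < n) ('X_i : {mpoly rat[n]})).
under eq_bigr => i _ do under eq_bigr => j _ do rewrite !mxE.
rewrite -/(Delta_poly n) => <-.
rewrite -det_tr; apply: eq_bigr => s _.
rewrite -mul_mpolyC rmorphXn rmorphN1; congr (_ * _).
rewrite mpolyXE_id; apply: eq_bigr => i _.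
by rewrite !mxE mnmE.
Qed.

Lemma Delta_poly_neq0 : Delta_poly n != 0.
Proof.
apply/prodf_neq0 => i _; apply/prodf_neq0 => j ij.
rewrite subr_eq0; apply/eqP => /(congr1 (mcoeff U_(j))) /eqP.
have ij' : (i == j) = false by apply: ltn_eqF.
by rewrite !mcoeffXU eqxx ij' oner_eq0.
Qed.

(** Induction on the cardinal, removing the least element [x]: all of [K] lies between [x] and
    [n - 1], so [x <= n - #|K|], the last term of [stair n #|K|]. *)
Lemma sum_distinct_le (K : {set 'I_n}) : (\sum_(x in K) x <= stair n #|K|)%N.
Proof.
have [k cK] := ubnP #|K|; elim: k K cK => [//|k IH] K cK.
have [->|/set0Pn[x0 x0K]] := eqVneq K set0; first by rewrite big_set0.
pose x := [arg min_(x < x0 in K) x].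
have [xK xmin] : x \in K /\ forall y, y \in K -> (x <= y)%N.
  by rewrite /x; case: arg_minnP.
rewrite (big_setD1 x) //= (cardsD1 x) xK add1n /stair big_ord_recr /= addnC.
rewrite leq_add //; first by apply: IH; move: cK; rewrite (cardsD1 x) xK.
have : (#|K| <= n - x)%N.
  have -> : (n - x)%N = #|[set y : 'I_n | (x <= y)%N]|.
    have -> : [set y : 'I_n | (x <= y)%N] = ~: [set widen_ord (ltnW (ltn_ord x)) i | i : 'I_x].
      apply/setP => y; rewrite !inE leqNgt; congr (~~ _).
      apply/idP/imsetP => [yx|[i _ ->] //=].
      by exists (Ordinal yx) => //; apply: val_inj.
    rewrite cardsCs setCK card_imset ?card_ord // => i j /(congr1 val) /= ?.
    exact: val_inj.
  by apply/subset_leq_card/subsetP => y yK; rewrite inE xmin.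
by rewrite (cardsD1 x) xK add1n; move: (ltn_ord x) => /=; move: #|K :\ x| => c; lia.
Qed.

(** In each monomial of the Vandermonde product the exponents are distinct, so over [W] they add up
    to at most [stair n #|W|]. Some [mu b] exceeds the exponent of [x_b], and the derivative is
    zero. *)
Lemma dact_high_monomial (W : {set 'I_n}) (mu : 'I_n -> nat) :
  (stair n #|W| < \sum_(b in W) mu b)%N ->
  dact (\prod_(b in W) 'X_b ^+ mu b) (Delta_poly n) = 0.
Proof.
move=> h.
pose m := [multinom (if i \in W then mu i else 0%N) | i < n].
have -> : \prod_(b in W) 'X_b ^+ mu b = 'X_[m] :> {mpoly rat[n]}.
  rewrite mpolyXE_id big_mkcond; apply: eq_bigr => i _.
  by rewrite mnmE; case: ifP; rewrite ?expr0.
rewrite Delta_polyE dact_sumr big1 // => s _; rewrite dactZr dactX mderivmX.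
have [b bW sb] : exists2 b, b \in W & (s b < mu b)%N.
  apply/exists_inP; apply: contraLR h; rewrite negb_exists_in -leqNgt.
  move=> /forall_inP h; apply: (@leq_trans (\sum_(b in W) s b)).
    by apply: leq_sum => b bW; rewrite leqNgt h.
  have := sum_distinct_le (s @: W); rewrite card_imset; last exact: perm_inj.
  by rewrite big_imset //= => ? ? _ _; exact: perm_inj.
by rewrite (bigD1 b) //= !mnmE bW ffact_small // mul0n scale0r scaler0.
Qed.

(** In the term of the permutation [s], differentiating the variables of [S] affects the rows
    [C = s @: S] of the Vandermonde matrix. Grouping by [C] gives a sum of determinants, each with a
    zero row or two proportional rows. *)
Lemma dact_esym r : (0 < r)%N ->
  dact (\sum_(S : {set 'I_n} | #|S| == r) \prod_(i in S) 'X_i) (Delta_poly n) = 0.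
Proof.
move=> r0; pose N (C : {set 'I_n}) : 'M[{mpoly rat[n]}]_n :=
  \matrix_(j, i) (if j \in C then (j : nat)%:R * 'X_i ^+ j.-1 else 'X_i ^+ j).
(* In [N C], the row of the least [c \in C] is [c] times the row of [c.-1]. *)
transitivity (\sum_(C : {set 'I_n} | #|C| == r) \det (N C)); last first.
  rewrite big1 // => C /eqP cC.
  have [x0 x0C] : exists x, x \in C by apply/set0Pn; rewrite -card_gt0 cC.
  pose c := [arg min_(x < x0 in C) x].
  have [cinC cmin] : c \in C /\ forall y, y \in C -> (c <= y)%N.
    by rewrite /c; case: arg_minnP.
  pose B : 'M[{mpoly rat[n]}]_n := \matrix_(j, i) (if j == c then 'X_i ^+ c.-1 else N C j i).
  rewrite (@determinant_multilinear _ _ (N C) B (N C) c (c : nat)%:R 0) //.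
  - rewrite mul0r addr0; case: (posnP c) => [->|c0]; first by rewrite mul0r.
    have c1 : (c.-1 < n)%N by have := ltn_ord c; lia.
    rewrite (@determinant_alternate _ _ B (Ordinal c1) c) ?mulr0 //.
      by rewrite -val_eqE /=; lia.
    move=> i; rewrite !mxE eqxx -val_eqE /= (_ : (c.-1 == c) = false); last by lia.
    case: ifP => // /cmin /=; lia.
  - by rewrite scale0r addr0; apply/rowP => i; rewrite 5!mxE eqxx cinC.
  - by apply/matrixP => j i; rewrite !mxE eq_sym (negbTE (neq_lift _ _)).
rewrite dact_sum Delta_polyE.
under eq_bigr => S _ do rewrite dact_sumr.
under [RHS]eq_bigr => C _ do rewrite -det_tr.
rewrite exchange_big [RHS]exchange_big /=; apply: eq_bigr => s _.
rewrite (reindex (fun C : {set 'I_n} => s @^-1: C)) /=; last first.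
  exists (fun C : {set 'I_n} => s @: C) => C _; apply/setP => i.
    apply/imsetP/idP => [[j]|iC]; first by rewrite inE => ? ->.
    by exists ((s^-1)%g i); rewrite ?inE permKV.
  by rewrite inE mem_imset //; exact: perm_inj.
apply: eq_big => [C|C _].
  rewrite -(card_imset _ (@perm_inj _ s)); congr (_ == _); apply: eq_card => i.
  apply/imsetP/idP => [[j]|iC]; first by rewrite inE => ? ->.
  by exists ((s^-1)%g i); rewrite ?inE permKV.
pose m := [multinom ((s i \in C) : nat) | i < n].
have -> : \prod_(i in s @^-1: C) 'X_i = 'X_[m] :> {mpoly rat[n]}.
  rewrite mpolyXE_id big_mkcond; apply: eq_bigr => i _.
  by rewrite mnmE inE; case: ifP.
rewrite dactZr dactX mderivmX -mul_mpolyC rmorphXn rmorphN1; congr (_ * _).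
rewrite -mul_mpolyC mpolyC_nat natr_prod mpolyXE_id -big_split.
apply: eq_bigr => i _; rewrite !mxE mnmBE !mnmE.
by case: ifP => _ /=; rewrite ?ffactn0 ?ffactn1 ?subn1 ?subn0 ?mul1r.
Qed.
End DifferentialAction.

(** * The coinvariant ring, as the quotient by the annihilator of the Vandermonde product *)

Section CoinvariantRing.
Variable n : nat.

Definition delta_annihilator (g : {mpoly rat[n]}) : bool := dact g (Delta_poly n) == 0.

(** Products act by composition, whence the closure; [1] is excluded since the Vandermonde product
    is nonzero, so the quotient is a nonzero ring. *)
Lemma delta_annihilator_idealr : idealr_closed delta_annihilator.
Proof.
split=> [||a u v]; rewrite !unfold_in /delta_annihilator ?dact0 //.
  by rewrite dact1 Delta_poly_neq0.
by move=> /eqP hu /eqP hv; rewrite dactD dactM hu hv dact0r addr0.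
Qed.

HB.instance Definition _ := isIdealr.Build {mpoly rat[n]} delta_annihilator
  delta_annihilator_idealr.

Definition delta_ideal : idealr {mpoly rat[n]} := delta_annihilator.

Definition coinv : comNzRingType := {ideal_quot delta_ideal}.

Definition to_coinv : {rmorphism {mpoly rat[n]} -> coinv} := \pi_({ideal_quot delta_ideal})%qT.

Lemma to_coinv_eq0 g : (to_coinv g == 0) = (dact g (Delta_poly n) == 0).
Proof.
have := Quotient.idealrBE delta_ideal g 0; rewrite subr0 => e.
by rewrite -(rmorph0 to_coinv); apply/esym/e.
Qed.

Definition coinvX (b : 'I_n) : coinv := to_coinv 'X_b.

(** The coefficients of positive degree are, up to sign, the elementary symmetric polynomials in all
    variables, which annihilate the Vandermonde product. *)
Lemma coinv_prod_lin : \prod_i lin (coinvX i) = 1.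
Proof.
have -> : \prod_i lin (coinvX i) = \prod_(i in [set: 'I_n]) lin (coinvX i).
  by apply: eq_bigl => i; rewrite inE.
apply/polyP => r; rewrite coef_prod_lin coef1 /esym_on.
under eq_bigl => S do rewrite subsetT andbT.
case: r => [|r].
  rewrite expr0 mul1r (big_pred1 set0) ?big_set0 // => S; exact: cards_eq0.
under eq_bigr => S _ do rewrite -rmorph_prod.
rewrite -rmorph_sum (_ : to_coinv _ = 0) ?mulr0 //.
by apply/eqP; rewrite to_coinv_eq0 dact_esym.
Qed.

Lemma coinv_high_deg (W : {set 'I_n}) (mu : 'I_n -> nat) :
  (stair n #|W| < \sum_(b in W) mu b)%N -> \prod_(b in W) coinvX b ^+ mu b = 0.
Proof.
move=> h; under eq_bigr => b _ do rewrite -rmorphXn.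
by rewrite -rmorph_prod; apply/eqP; rewrite to_coinv_eq0 dact_high_monomial.
Qed.
End CoinvariantRing.

(** * The coefficients of [d_{j_1} ... d_{j_k} Delta_n] *)

Section DeterminantExpansion.
Variable n : nat.
Implicit Types (w : superspace n) (p : {mpoly rat[n]}).

Lemma iter_pdxE i (j : 'I_n) w S : iter i (pdx j) w S = dact ('X_j ^+ i) (w S).
Proof.
elim: i => [|i IH]; first by rewrite expr0 dact1.
by rewrite iterS ffunE IH exprS dactM dactX mderivmU1m.
Qed.

Lemma dopE i w (T : {set 'I_n}) :
  dop i w T =
  \sum_(j in T) (-1) ^+ #|[set t in T | (t < j)%N]| *: dact ('X_j ^+ i) (w (T :\ j)).
Proof.
rewrite /dop sum_ffunE [RHS]big_mkcond; apply: eq_bigr => j _.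
by rewrite ffunE iter_pdxE.
Qed.

Lemma dops_card_neq (js : seq nat) p (T : {set 'I_n}) :
  #|T| != size js -> dops js (even_part p) T = 0.
Proof.
elim: js T => [|j js IH] T /= cT.
  by rewrite ffunE -cards_eq0 (negbTE cT).
rewrite dopE big1 // => t tT; rewrite IH ?dact0r ?scaler0 //.
by move: cT; rewrite (cardsD1 t T) tT.
Qed.

(** Induction on [js]: the outermost operator supplies the first row of a Laplace expansion, and the
    sign from moving [theta_j] past the smaller thetas is the cofactor sign. *)
Lemma dops_det k (js : seq nat) p (phi : 'I_k -> 'I_n) :
  size js = k -> {homo phi : i j / (i < j)%N} ->
  dops js (even_part p) [set phi m | m : 'I_k] =
  dact (\det (\matrix_(l < k, m < k) 'X_(phi m) ^+ nth 0%N js l)) p.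
Proof.
elim: k js phi => [|k IH] [|j js] // phi; last move=> [sj] mono.
  move=> _ _; rewrite det_mx00 dact1 /= ffunE (_ : imset _ _ = set0) ?eqxx //.
  by apply/setP => x; rewrite inE; apply/imsetP => -[[]].
have mono' : {mono phi : i j / (i < j)%N}.
  move=> a b; case: (ltngtP a b) => [/mono -> //|/mono ab|/val_inj ->]; last by rewrite ltnn.
  by apply/negbTE; rewrite -leqNgt ltnW.
have pinj : injective phi.
  move=> a b ab; apply: val_inj; case: (ltngtP a b) => // /mono; rewrite ab ltnn //.
rewrite /= dopE (expand_det_row _ 0) dact_sum big_imset /=; last by move=> ? ? _ _; exact: pinj.
apply: eq_bigr => m _.
have -> : #|[set t in [set phi x | x : 'I_k.+1] | (t < phi m)%N]| = m.
  transitivity #|[set phi (widen_ord (ltnW (ltn_ord m)) i) | i : 'I_m]|; last first.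
    by rewrite card_imset ?card_ord // => a b /pinj /(congr1 val) /= /val_inj.
  apply: eq_card => t; rewrite inE; apply/andP/imsetP => [[/imsetP[x _ ->]]|[i _ ->]].
    by rewrite mono' => xm; exists (Ordinal xm) => //; congr phi; apply: val_inj.
  by rewrite mono' /= ltn_ord imset_f.
have -> : [set phi x | x : 'I_k.+1] :\ phi m = [set (phi \o lift m) i | i : 'I_k].
  apply/setP => t; rewrite !inE; apply/andP/imsetP => [[tm /imsetP[x _ tx]]|[i _ ->]].
    have [y xy|xm] := unliftP m x; last by rewrite tx xm eqxx in tm.
    by exists y; rewrite //= -xy.
  by rewrite /= (inj_eq pinj) eq_sym neq_lift imset_f.
rewrite (IH js (phi \o lift m)) //; last first.
  by move=> a b ab; apply: mono => /=; rewrite /bump; lia.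
rewrite mxE /cofactor add0n mulrCA -dactM -dactZ -mul_mpolyC rmorphXn rmorphN1.
congr (dact (_ * (_ * \det _)) p).
by apply/matrixP => a b; rewrite !mxE.
Qed.
End DeterminantExpansion.

(** * From index sets to tuples of exponents *)

Section TailSums.
Variables (n r s a M : nat) (h : seq nat).
Hypotheses (n_gt0 : (0 < n)%N) (size_h : size h = r) (h_sorted : sorted ltn h).
Hypotheses (h_gt0 : all (leq 1) h) (h_lt : all (fun x => x < n)%N h).
Hypotheses (h_lt_a : all (fun x => x < a)%N h) (a_gt0 : (0 < a)%N).
(* [M] is the sum of the last [s] elements of [I], namely [a], [n-s+1], ..., [n-1]. *)
Hypotheses (sn : (s <= n)%N) (hM : (M + (n - s) = stair n s + a)%N).

Definition tail_values (f : {ffun 'I_s -> 'I_n}) : seq nat := [seq val (f l) | l <- enum 'I_s].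

Definition set_of_tail (f : {ffun 'I_s -> 'I_n}) : {set 'I_n} :=
  [set j : 'I_n | (val j).+1 \in h ++ tail_values f].

(** The index sets of the theorem: [h] is the prescribed beginning, and [d >= 0] is written without
    subtraction. *)
Definition valid_set (J : {set 'I_n}) : bool :=
  [&& [forall j in J, (val j < n.-1)%N], #|J| == (r + s)%N,
      take r (sorted_elems J) == h &
      (M <= \sum_(l < s) nth 0 (sorted_elems J) (r + l))%N].

(** All elements of a valid [J] are below [n], so on such sets [insubd] never returns its
    default. *)
Definition tail_fun (J : {set 'I_n}) : {ffun 'I_s -> 'I_n} :=
  [ffun l : 'I_s => insubd (Ordinal n_gt0) (nth 0%N (sorted_elems J) (r + l))].

Lemma mem_sorted_elems (J : {set 'I_n}) (x : nat) :
  (x \in sorted_elems J) = [exists j in J, x == (val j).+1].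
Proof.
rewrite mem_sort; apply/mapP/exists_inP => [[j jJ ->]|[j jJ /eqP ->]].
  by exists j; rewrite ?eqxx // -mem_enum.
by exists j; rewrite ?mem_enum.
Qed.

Lemma uniq_sorted_elems (J : {set 'I_n}) : uniq (sorted_elems J).
Proof. by rewrite sort_uniq map_inj_uniq ?enum_uniq // => i j [] /val_inj. Qed.

Lemma size_sorted_elems (J : {set 'I_n}) : size (sorted_elems J) = #|J|.
Proof. by rewrite size_sort size_image. Qed.

(** If [f l < a], the other [s - 1] distinct values add up to at most [stair n s.-1 = M - a], and
    the total falls below [M]. Hence the tail automatically lies above [h]. *)
Lemma tail_sum_ge (f : {ffun 'I_s -> 'I_n}) : injective f -> (M <= \sum_(l < s) f l)%N -> forall l, (a <= f l)%N.
Proof.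
move=> finj Mf l; rewrite leqNgt; apply/negP => fla.
have s0 : (0 < s)%N by apply: leq_trans (ltn_ord l).
have : (\sum_(i < s | i != l) f i <= stair n s.-1)%N.
  have := sum_distinct_le [set f i | i in [pred i | i != l]].
  rewrite card_imset // big_imset /=; last by move=> ? ? _ _; exact: finj.
  by rewrite cardC1 card_ord.
have hs : stair n s = (stair n s.-1 + (n - s))%N.
  by rewrite /stair -[in LHS](prednK s0) big_ord_recr /=; congr (_ + _)%N; lia.
move: Mf; rewrite (bigD1 l) //=; move: (\sum_(i < s | i != l) f i)%N => R; lia.
Qed.

Lemma sum_nth_drop (js : seq nat) : size js = (r + s)%N ->
  (\sum_(l < s) nth 0 js (r + l) = sumn (drop r js))%N.
Proof.
move=> sj; rewrite sumnE (big_nth 0%N) size_drop sj addKn big_mkord.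
by apply: eq_bigr => l _; rewrite nth_drop.
Qed.

Lemma sumn_tail_values (f : {ffun 'I_s -> 'I_n}) : sumn (tail_values f) = (\sum_(l < s) f l)%N.
Proof. by rewrite sumnE big_map big_enum. Qed.

Lemma sorted_elems_set_of_tail (f : {ffun 'I_s -> 'I_n}) : injective f -> (M <= \sum_(l < s) f l)%N ->
  sorted_elems (set_of_tail f) = h ++ sort leq (tail_values f).
Proof.
move=> finj Mf; have fa := tail_sum_ge finj Mf.
have ta : all (leq a) (tail_values f) by apply/allP => x /mapP[l _ ->]; exact: fa.
have ht x : x \in h ++ tail_values f -> (0 < x < n)%N.
  rewrite mem_cat => /orP[xh|/mapP[l _ ->]].
    by rewrite (allP h_lt _ xh) (allP h_gt0 _ xh).
  by rewrite (leq_trans a_gt0 (fa l)) ltn_ord.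
apply: (@sorted_eq _ leq); [exact: leq_trans|exact: anti_leq|exact: sort_sorted leq_total _| |].
  rewrite (sorted_pairwise leq_trans) pairwise_cat -!(sorted_pairwise leq_trans).
  rewrite (sort_sorted leq_total) andbT; apply/andP; split.
    apply/allrelP => x y xh; rewrite mem_sort => yt.
    by apply: leq_trans (allP ta _ yt); apply: ltnW; exact: (allP h_lt_a _ xh).
  by move: h_sorted; rewrite ltn_sorted_uniq_leq => /andP[].
apply: uniq_perm; first exact: uniq_sorted_elems.
  rewrite cat_uniq sort_uniq map_inj_uniq ?enum_uniq => [|l l' /val_inj /finj //].
  rewrite andbT (sorted_uniq ltn_trans ltnn h_sorted) /=.
  apply/hasPn => x; rewrite mem_sort => /(allP ta) ax; apply/negP => /(allP h_lt_a).
  by rewrite ltnNge ax.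
move=> x; rewrite mem_sorted_elems.
have -> : (x \in h ++ sort leq (tail_values f)) = (x \in h ++ tail_values f).
  by rewrite !mem_cat mem_sort.
apply/exists_inP/idP => [[j]|xt]; first by rewrite inE => jt /eqP ->.
have /andP[x0 xn] := ht x xt.
have xn' : (x.-1 < n)%N by lia.
by exists (Ordinal xn'); rewrite ?inE /= prednK.
Qed.

Lemma sorted_elems_valid J : valid_set J ->
  sorted_elems J = h ++ tail_values (tail_fun J).
Proof.
case/and4P => /forall_inP Jn /eqP cJ /eqP tJ _.
rewrite -[LHS](cat_take_drop r) tJ; congr (_ ++ _).
have sJ : size (sorted_elems J) = (r + s)%N by rewrite size_sorted_elems.
apply: (@eq_from_nth _ 0%N); first by rewrite size_drop sJ addKn size_map size_enum_ord.
rewrite size_drop sJ addKn => i si.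
rewrite nth_drop (nth_map (Ordinal si)) ?size_enum_ord // ffunE val_insubd.
rewrite nth_enum_ord //.
have : nth 0%N (sorted_elems J) (r + i) \in sorted_elems J.
  by rewrite mem_nth // sJ ltn_add2l.
rewrite mem_sorted_elems => /exists_inP[j /Jn jn /eqP ->].
by rewrite ifT // -ltn_predRL.
Qed.

Lemma tail_fun_inj J : valid_set J -> injective (tail_fun J).
Proof.
move=> vJ l l' e; have := uniq_sorted_elems J.
rewrite (sorted_elems_valid vJ) cat_uniq => /and3P[_ _ ut].
have : injective (fun l => val (tail_fun J l)) by apply/injectiveP.
by apply; rewrite e.
Qed.

Lemma set_of_tail_perm J (sg : 'S_s) : valid_set J ->
  set_of_tail [ffun l => tail_fun J (sg l)] = J.
Proof.
move=> vJ; apply/setP => j; rewrite inE mem_cat.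
have -> : ((val j).+1 \in tail_values [ffun l => tail_fun J (sg l)]) =
          ((val j).+1 \in tail_values (tail_fun J)).
  apply/mapP/mapP => -[l _ ->].
    by exists (sg l); rewrite ?mem_enum ?ffunE.
  by exists ((sg^-1)%g l); rewrite ?mem_enum // [in RHS]ffunE permKV.
rewrite -mem_cat -sorted_elems_valid // mem_sorted_elems.
apply/exists_inP/idP => [[i iJ /eqP[/val_inj ->]] //|jJ].
by exists j.
Qed.

Lemma sum_tail_fun J : valid_set J -> (M <= \sum_l tail_fun J l)%N.
Proof.
move=> vJ; have /and4P[_ /eqP cJ _ Mj] := vJ.
rewrite -sumn_tail_values; apply: leq_trans Mj _.
rewrite sum_nth_drop ?size_sorted_elems // (sorted_elems_valid vJ).
by rewrite drop_size_cat.
Qed.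

Lemma valid_set_of_tail (f : {ffun 'I_s -> 'I_n}) : injective f -> (M <= \sum_(l < s) f l)%N ->
  valid_set (set_of_tail f).
Proof.
move=> finj Mf; have e := sorted_elems_set_of_tail finj Mf.
have se : size (sorted_elems (set_of_tail f)) = (r + s)%N.
  by rewrite e size_cat size_sort size_map size_enum_ord size_h.
apply/and4P; split.
- apply/forall_inP => j; rewrite inE mem_cat => /orP[/(allP h_lt)|/mapP[l _ jl]]; first by rewrite -ltn_predRL.
  by have := ltn_ord (f l); rewrite -[nat_of_ord _]jl -ltn_predRL.
- by rewrite -size_sorted_elems se.
- by rewrite e take_size_cat.
- rewrite sum_nth_drop // e drop_size_cat // (perm_sumn (permEl (perm_sort _ _))).
  by rewrite sumn_tail_values.
Qed.

Lemma tail_fun_surj (f : {ffun 'I_s -> 'I_n}) : injective f -> (M <= \sum_(l < s) f l)%N ->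
  exists sg : 'S_s, f = [ffun l => tail_fun (set_of_tail f) (sg l)].
Proof.
move=> finj Mf; set J := set_of_tail f.
have : perm_eq (tail_values f) (tail_values (tail_fun J)).
  have := sorted_elems_valid (valid_set_of_tail finj Mf).
  rewrite sorted_elems_set_of_tail // => /eqP; rewrite eqseq_cat // eqxx /= => /eqP <-.
  by rewrite perm_sym perm_sort.
have sT : size (tail_values (tail_fun J)) == s by rewrite size_map size_enum_ord.
rewrite -[tail_values (tail_fun J)]/(val (Tuple sT)) => /tuple_permP[sg e].
exists sg; apply/ffunP => l; rewrite ffunE; apply: val_inj.
have := congr1 (fun t => nth 0%N t l) e.
rewrite /= (nth_map l) ?size_enum_ord // nth_ord_enum => ->.
rewrite (nth_map l) ?size_enum_ord // nth_ord_enum (tnth_nth 0%N) /=.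
by rewrite (nth_map l) ?size_enum_ord // nth_ord_enum.
Qed.

(** The fibre of [set_of_tail] over a valid [J] consists of the rearrangements of [tail_fun J],
    pairwise distinct because [tail_fun J] is injective. *)
Lemma sum_valid_sets (Q : zmodType) (F : {ffun 'I_s -> 'I_n} -> Q) :
  \sum_(J | valid_set J) \sum_(sg : 'S_s) F [ffun l => tail_fun J (sg l)] =
  \sum_(f : {ffun 'I_s -> 'I_n} | injectiveb f && (M <= \sum_l f l)%N) F f.
Proof.
rewrite [RHS](partition_big set_of_tail valid_set) /=; last first.
  by move=> f /andP[/injectiveP finj Mf]; exact: valid_set_of_tail.
apply: eq_bigr => J vJ.
have tE (sg : 'S_s) l : [ffun l => tail_fun J (sg l)] l = tail_fun J (sg l).
  by rewrite [LHS]ffunE.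
rewrite [RHS](reindex (fun sg : 'S_s => [ffun l => tail_fun J (sg l)])) /=.
  apply: eq_bigl => sg; apply/esym.
  rewrite set_of_tail_perm // eqxx andbT; apply/andP; split.
    by apply/injectiveP => l l'; rewrite !tE => e; exact: (perm_inj (tail_fun_inj vJ e)).
  apply: leq_trans (sum_tail_fun vJ) _; rewrite (reindex_inj (@perm_inj _ sg)) /=.
  by apply: eq_leq; apply: eq_bigr => l _; rewrite tE.
exists (fun f => odflt 1%g [pick sg : 'S_s | f == [ffun l => tail_fun J (sg l)]]).
  move=> sg _; case: pickP => [sg' /eqP/ffunP e|/(_ sg)]; last by rewrite eqxx.
  apply/permP => l; have := e l; rewrite !tE => el; exact/esym/(tail_fun_inj vJ el).
move=> f; rewrite inE => /andP[/andP[/injectiveP finj Mf] /eqP fJ].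
case: pickP => [sg /eqP -> //|].
by have [sg e] := tail_fun_surj finj Mf; move/(_ sg); rewrite {1}e fJ eqxx.
Qed.

End TailSums.

(** * Determinants *)

(** The change of basis from the powers is triangular with unit diagonal, so the Vandermonde
    determinant is unchanged. *)
Lemma det_monic_basis (Q : comNzRingType) s (p : 'I_s -> {poly Q}) (y : 'I_s -> Q) :
  (forall c, p c \is monic) -> (forall c : 'I_s, size (p c) = c.+1) ->
  \det (\matrix_(v < s, c < s) (p c).[y v]) =
  \prod_(w < s) \prod_(v < s | (v < w)%N) (y w - y v).
Proof.
move=> pmon psize; pose L : 'M[Q]_s := \matrix_(c, i) (p c)`_i.
have -> : \matrix_(v < s, c < s) (p c).[y v] = (L *m Vandermonde s (\row_i y i))^T.
  apply/matrixP => v c; rewrite !mxE (@horner_coef_wide _ s) ?psize //.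
  by apply: eq_bigr => i _; rewrite !mxE.
rewrite det_tr det_mulmx det_Vandermonde det_trig; last first.
  by apply/is_trig_mxP => i j ij; rewrite mxE nth_default // psize.
rewrite big1 ?mul1r => [|c _]; last first.
  by rewrite mxE; have /monicP := pmon c; rewrite lead_coefE psize.
rewrite (exchange_big_dep xpredT) //=; apply: eq_bigr => w _.
by apply: eq_bigr => v _; rewrite !mxE.
Qed.

(** [(y + c) ^_ c] is [(y + 1) ... (y + c)], monic of degree [c] in [y]. This basis is chosen
    because it is [c!] times the coefficient ['C(y + c, y)] found in the power [c + 1] of a
    geometric series. *)
Lemma Delta_num_det s (y : seq nat) : size y = s ->
  Delta_num y = \det (\matrix_(v < s, c < s) ((nth 0%N y v + c) ^_ c)%:R).
Proof.
move=> <-; pose p (c : 'I_(size y)) : {poly rat} := \prod_(i < c) ('X - (- i.+1%:R)%:P).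
rewrite /Delta_num -(@det_monic_basis _ _ p (fun v => (nth 0%N y v)%:R)); first last.
- by move=> c; rewrite size_prod_XsubC /index_enum -enumT size_enum_ord.
- by move=> c; exact: monic_prod_XsubC.
congr (\det _); apply/matrixP => v c; rewrite !mxE horner_prod ffact_prod natr_prod.
rewrite [RHS](reindex_inj rev_ord_inj); apply: eq_bigr => i _.
rewrite hornerXsubC opprK -natrD /=; congr (_%:R).
by have := ltn_ord i; lia.
Qed.

Lemma det_col_mx_perm (Q : comNzRingType) r s (A : 'M[Q]_(r, r + s))
    (B : 'M[Q]_(s, r + s)) (sg : 'S_s) :
  \det (col_mx A (row_perm sg B)) = (-1) ^+ sg * \det (col_mx A B).
Proof.
have -> : col_mx A (row_perm sg B) = block_mx 1%:M 0 0 (perm_mx sg) *m col_mx A B.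
  by rewrite mul_block_col mul1mx !mul0mx addr0 add0r row_permE.
by rewrite det_mulmx det_ublock det1 mul1r det_perm.
Qed.

(** * Expansion of the two determinants and summation over the index sets *)

Section TailDeterminants.
Variables (Q : comNzRingType) (n : nat) (xi : 'I_n -> Q).
Hypothesis prod_lin1 : \prod_i lin (xi i) = 1.
Hypothesis high_deg0 : forall (W : {set 'I_n}) (mu : 'I_n -> nat),
  (stair n #|W| < \sum_(b in W) mu b)%N -> \prod_(b in W) xi b ^+ mu b = 0.
Variables (r s u a M : nat) (h : seq nat) (phi : 'I_(r + s) -> 'I_n).
Hypothesis phi_inj : injective phi.

Definition exponent_det (f : {ffun 'I_s -> 'I_n}) : Q :=
  \det (col_mx (\matrix_(l < r, m < r + s) xi (phi m) ^+ nth 0%N h l)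
               (\matrix_(l < s, m < r + s) xi (phi m) ^+ f l)).

Definition rising_det (f : {ffun 'I_s -> 'I_n}) : Q :=
  \det (\matrix_(v < s, c < s) ((f v + c) ^_ c)%:R).

Definition weighted_det (f : {ffun 'I_s -> 'I_n}) : Q :=
  (\prod_(c < s) ((f c + c) ^_ c)%:R) * exponent_det f.

Lemma exponent_det_perm (f : {ffun 'I_s -> 'I_n}) (sg : 'S_s) :
  exponent_det [ffun l => f (sg l)] = (-1) ^+ sg * exponent_det f.
Proof.
rewrite -det_col_mx_perm; congr (\det (col_mx _ _)).
by apply/matrixP => l m; rewrite !mxE ffunE.
Qed.

Lemma exponent_det_ninj (f : {ffun 'I_s -> 'I_n}) :
  ~~ injectiveb f -> exponent_det f = 0.
Proof.
case/injectivePn => i [j ij fij].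
rewrite /exponent_det (@determinant_alternate _ _ _ (rshift r i) (rshift r j)) //.
  by rewrite (inj_eq (@rshift_inj _ _)).
by move=> m; rewrite !col_mxEd !mxE fij.
Qed.

(** The sign in the Leibniz expansion of [rising_det] is absorbed by permuting the last [s] rows of
    [exponent_det]. *)
Lemma rising_exponent_det (f : {ffun 'I_s -> 'I_n}) :
  rising_det f * exponent_det f = \sum_(sg : 'S_s) weighted_det [ffun l => f (sg l)].
Proof.
rewrite /rising_det -det_tr /determinant mulr_suml; apply: eq_bigr => sg _.
rewrite /weighted_det exponent_det_perm mulrCA -mulrA; congr (_ * (_ * _)).
by apply: eq_bigr => c _; rewrite !mxE ffunE.
Qed.

(** The value [0] covers [d > n - s], where the elementary symmetric polynomial has negative
    index. *)
Definition tail_coef (Z : {set 'I_n}) (m : nat) : Q :=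
  if (m <= M + (n - s))%N then
    (-1) ^+ (m - M) * 'C(m - M + u, u)%:R * esym_on xi Z (n - s - (m - M))
  else 0.

Lemma sum_weighted_det0 (Z : {set 'I_n}) :
  (s <= n)%N -> #|Z| = (n - s + u)%N -> (0 < a)%N ->
  (M + (n - s) = stair n s + a)%N ->
  \sum_(f : {ffun 'I_s -> 'I_n} | (M <= \sum_l f l)%N)
    tail_coef Z (\sum_l f l) * weighted_det f = 0.
Proof.
move=> sn cZ a0 hM.
(* Leibniz expansion of [exponent_det]: [X pi] collects what is independent of [f], including the
   [c!] split off from the falling factorials. For fixed [pi], the sum over [f] is an instance of
   [vanishing_sum]. *)
pose X (pi : 'S_(r + s)) : Q :=
  (-1) ^+ pi * \prod_(l < r) xi (phi (pi (lshift s l))) ^+ nth 0%N h l * \prod_(c < s) (c`!)%:R.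
pose E (f : {ffun 'I_s -> 'I_n}) (pi : 'S_(r + s)) : Q :=
  \prod_(c < s) ('C(f c + c, f c)%:R * xi (phi (pi (rshift r c))) ^+ f c).
have wE f : weighted_det f = \sum_(pi : 'S_(r + s)) X pi * E f pi.
  rewrite /weighted_det /exponent_det /determinant mulr_sumr; apply: eq_bigr => pi _.
  rewrite big_split_ord /=.
  under [X in _ * (_ * (X * _))]eq_bigr => l _ do rewrite col_mxEu mxE.
  under [X in _ * (_ * (_ * X))]eq_bigr => l _ do rewrite col_mxEd mxE.
  rewrite /X /E !big_split /=.
  have -> : \prod_(c < s) ((f c + c) ^_ c)%:R =
      \prod_(c < s) (c`!)%:R * \prod_(c < s) 'C(f c + c, f c)%:R :> Q.
    rewrite -big_split; apply: eq_bigr => c _ /=.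
    by rewrite -natrM -bin_ffact mulnC -(bin_sub (leq_addl _ _)) addnK.
  by rewrite -[RHS]mulrA [X in _ = _ * X]mulrA [X in _ * X = _]mulrA mulrCA.
under eq_bigr => f _ do rewrite wE mulr_sumr.
rewrite exchange_big big1 //= => pi _.
have binj : injective (fun c : 'I_s => phi (pi (rshift r c))).
  by move=> c c' /phi_inj /perm_inj /rshift_inj.
rewrite -[RHS](mulr0 (X pi)) -[in RHS](vanishing_sum prod_lin1 high_deg0 binj sn cZ a0 hM).
rewrite mulr_sumr [LHS]big_mkcond [RHS]big_mkcond; apply: eq_bigr => f _ /=.
rewrite /tail_coef; case: leqP => //= _.
by case: leqP => // _; rewrite ?mul0r // mulrCA.
Qed.

Hypotheses (n_gt0 : (0 < n)%N) (size_h : size h = r) (h_sorted : sorted ltn h).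
Hypotheses (h_gt0 : all (leq 1) h) (h_lt : all (fun x => x < n)%N h).
Hypotheses (h_lt_a : all (fun x => x < a)%N h) (a_gt0 : (0 < a)%N).
Hypotheses (sn : (s <= n)%N) (hM : (M + (n - s) = stair n s + a)%N).

(** Valid sets and permutations together give the injective tuples; the other tuples repeat a row
    and contribute zero, so the sum over all tuples applies. *)
Lemma sum_valid_det0 (Z : {set 'I_n}) : #|Z| = (n - s + u)%N ->
  \sum_(J | valid_set r s M h J)
    tail_coef Z (\sum_l tail_fun r s n_gt0 J l) *
    (rising_det (tail_fun r s n_gt0 J) * exponent_det (tail_fun r s n_gt0 J)) = 0.
Proof.
move=> cZ; rewrite -[RHS](sum_weighted_det0 sn cZ a_gt0 hM).
transitivity (\sum_(f : {ffun 'I_s -> 'I_n} | injectiveb f && (M <= \sum_l f l)%N)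
    tail_coef Z (\sum_l f l) * weighted_det f).
  rewrite -(sum_valid_sets n_gt0 size_h h_sorted h_gt0 h_lt h_lt_a a_gt0 sn hM).
  apply: eq_bigr => J vJ; rewrite rising_exponent_det mulr_sumr; apply: eq_bigr => sg _.
  congr (tail_coef Z _ * _); rewrite [LHS](reindex_inj (@perm_inj _ sg)) /=.
  by apply: eq_bigr => l _; rewrite [in RHS]ffunE.
rewrite [LHS]big_mkcond [RHS]big_mkcond; apply: eq_bigr => f _ /=.
case: (boolP (injectiveb f)) => //= /exponent_det_ninj e.
by rewrite /weighted_det e !mulr0 if_same.
Qed.

End TailDeterminants.

(** * Images in the coinvariant ring, and the conclusion *)

Section CoinvariantImages.
Variable n : nat.

Lemma to_coinv_scale (c : rat) (g : {mpoly rat[n]}) :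
  to_coinv n (c *: g) = to_coinv n c%:MP * to_coinv n g.
Proof. by rewrite -mul_mpolyC rmorphM. Qed.

Lemma to_coinv_esym_first m r :
  to_coinv n (esym_first n m (Posz r)) = esym_on (@coinvX n) [set i : 'I_n | (i < m)%N] r.
Proof.
rewrite /= rmorph_sum; apply: eq_big => [S|S _]; last by rewrite rmorph_prod.
congr (_ && _); apply/forall_inP/subsetP => SZ i /SZ; by rewrite inE.
Qed.

Lemma to_coinv_Delta_num s (y : seq nat) (f : {ffun 'I_s -> 'I_n}) :
  size y = s -> (forall l : 'I_s, nth 0%N y l = f l) ->
  to_coinv n (Delta_num y)%:MP = rising_det (coinv n) f.
Proof.
move=> sy yf; rewrite (Delta_num_det sy) -det_map_mx -det_map_mx.
congr (\det _); apply/matrixP => v c; rewrite !mxE yf.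
by rewrite !rmorph_nat.
Qed.

Lemma enum_val_lt (T : {set 'I_n}) k (cT : k = #|T|) :
  {homo (fun m : 'I_k => enum_val (cast_ord cT m)) : i j / (i < j)%N}.
Proof.
move=> i j ij.
have sT : sorted (fun x y : 'I_n => (x < y)%N) (enum T).
  rewrite /enum_mem sorted_filter //; first by move=> x y z; exact: ltn_trans.
  by have := iota_ltn_sorted 0 n; rewrite -val_enum_ord sorted_map enumT.
rewrite /enum_val; set x0 := enum_default _.
rewrite (set_nth_default x0 (enum_default _)) -?cardE ?ltn_ord //.
apply: (sorted_ltn_nth _ _ sT) => //; rewrite ?inE -?cardE -?cT //.
by move=> x y z; exact: ltn_trans.
Qed.

End CoinvariantImages.

Theorem theorem1p13 (n k s u : nat) (I : seq nat) :
  (2 <= n)%N ->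
  size I = k ->
  sorted ltn I ->
  all (fun i => (1 <= i <= n.-1)%N) I ->
  (1 <= s <= k)%N ->
  (forall l : nat, (l < k - s + 1)%N -> (nth 0%N I l <= n - k)%N) ->
  (forall l : nat, (2 <= l <= s)%N -> nth 0%N I (k - s + l - 1) = (n - s + l - 1)%N) ->
  (u <= s)%N ->
  let js (J : {set 'I_n}) := sorted_elems J in
  let dJ (J : {set 'I_n}) : int :=
    \sum_(l < s) ((nth 0%N (js J) (k - s + l))%:Z - (nth 0%N I (k - s + l))%:Z) in
  \sum_(J : {set 'I_n} | [&& [forall j in J, (val j < n.-1)%N], #|J| == k,
                            take (k - s) (js J) == take (k - s) I & 0 <= dJ J])
     (((-1) ^+ `|dJ J|%N * Delta_num (drop (k - s) (js J))
        * ('C(`|dJ J| + u, u))%:R : rat)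
       *: pdpoly (esym_first n (n - s + u) ((n - s)%:Z - dJ J))
            (dops (js J) (even_part (Delta_poly n))))
  = 0.
Proof.
move=> n2 sI I_sorted I_range /andP[s1 sk] _ I_top us js dJ.
pose r := (k - s)%N; pose h := take r I; pose a := nth 0%N I r.
pose M := (\sum_(l < s) nth 0%N I (r + l))%N.
have kE : k = (r + s)%N by rewrite subnK.
have n0 : (0 < n)%N by lia.
have rI : (r < size I)%N by rewrite sI kE; lia.
have size_h : size h = r by rewrite size_takel // ltnW.
have I_mono i j : (i < j < size I)%N -> (nth 0%N I i < nth 0%N I j)%N.
  by case/andP=> ij js'; apply: (sorted_ltn_nth ltn_trans 0%N I_sorted) => //; rewrite inE ?(ltn_trans ij).
have I_in i : (i < size I)%N -> (1 <= nth 0%N I i <= n.-1)%N.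
  by move=> iI; apply: (allP I_range); exact: mem_nth.
have h_sorted : sorted ltn h by exact: take_sorted.
have h_range x : x \in h -> (1 <= x <= n.-1)%N by move/mem_take; exact: (allP I_range).
have h_gt0 : all (leq 1) h by apply/allP => x /h_range /andP[].
have h_lt : all (fun x => x < n)%N h by apply/allP => x /h_range; lia.
have h_lt_a : all (fun x => x < a)%N h.
  apply/allP => x /(nthP 0%N)[i]; rewrite size_h => ir <-.
  by rewrite nth_take //; apply: I_mono; rewrite ir.
have a0 : (0 < a)%N by have := I_in r rI; case/andP.
have sn : (s <= n)%N.
  have : (size (iota 1 n.-1) >= size I)%N.
    apply: uniq_leq_size; first exact: (sorted_uniq ltn_trans ltnn I_sorted).
    by move=> x /(allP I_range); rewrite mem_iota; lia.
  by rewrite size_iota sI; lia.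
(* [stair n s] is [(n - s) + (n - s + 1) + ... + (n - 1)]; [M] has the same terms except that [a]
   replaces [n - s]. *)
have hM : (M + (n - s) = stair n s + a)%N.
  have s1' : (s.-1 < s)%N by rewrite prednK.
  rewrite (stair_split sn s1') prednK // subnn {1}/stair big_ord0 add0n /M.
  rewrite -(big_mkord xpredT (fun l => nth 0 I (r + l))) -(big_mkord xpredT (fun l => n - s + l)%N).
  rewrite big_ltn // [in RHS]big_ltn // !addn0 -/a addnAC [RHS]addnC addnA; congr (_ + _ + _)%N.
  apply: eq_big_nat => l /andP[l1 ls].
  have := I_top l.+1; rewrite !addnS !subn1 /= => -> //; lia.
pose w0 := even_part (Delta_poly n).
apply/ffunP => T; rewrite sum_ffunE ffunE.
under eq_bigr => J _ do rewrite !ffunE -/(dact _ _).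
have js_size (J : {set 'I_n}) : #|J| == k -> size (js J) = k by rewrite size_sorted_elems => /eqP.
have [cT|cT] := eqVneq #|T| k; last first.
  rewrite big1 // => J /and4P[_ cJ _ _].
  by rewrite dops_card_neq ?js_size // dact0r scaler0.
(* [phi] lists [T] increasingly, as [dops_det] requires. *)
pose phi (m : 'I_(r + s)) := enum_val (cast_ord (etrans (esym kE) (esym cT)) m).
have phi_inj : injective phi by move=> i j /enum_val_inj/cast_ord_inj.
have Tphi : T = [set phi m | m : 'I_(r + s)].
  apply/esym/eqP; rewrite eqEcard card_imset // card_ord cT kE leqnn andbT.
  by apply/subsetP => x /imsetP[m _ ->]; exact: enum_valP.
pose Mx (J : {set 'I_n}) : 'M[{mpoly rat[n]}]_(r + s) := \matrix_(l, m) 'X_(phi m) ^+ nth 0%N (js J) l.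
have dopsE (J : {set 'I_n}) : #|J| == k -> dops (js J) w0 T = dact (\det (Mx J)) (Delta_poly n).
  by move=> cJ; rewrite [in LHS]Tphi dops_det ?js_size //; exact: enum_val_lt.
pose cf (J : {set 'I_n}) : rat := (-1) ^+ `|dJ J|%N * Delta_num (drop (k - s) (js J)) * ('C(`|dJ J| + u, u))%:R.
pose ef (J : {set 'I_n}) := esym_first n (n - s + u) ((n - s)%:Z - dJ J).
transitivity (dact (\sum_(J : {set 'I_n} | [&& [forall j in J, (val j < n.-1)%N], #|J| == k,
    take (k - s) (js J) == take (k - s) I & 0 <= dJ J]) cf J *: (ef J * \det (Mx J)))
    (Delta_poly n)).
  rewrite dact_sum; apply: eq_bigr => J /and4P[_ cJ _ _].
  by rewrite dactZ dactM -dopsE.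
(* The whole sum is now one polynomial acting on [Delta_poly n]; it remains to show that its class
   in the coinvariant ring is zero. *)
apply/eqP; rewrite -to_coinv_eq0 rmorph_sum; apply/eqP.
pose Z := [set i : 'I_n | (i < n - s + u)%N].
have cZ : #|Z| = (n - s + u)%N.
  have lZ : (n - s + u <= n)%N by lia.
  transitivity #|[set widen_ord lZ i | i : 'I_(n - s + u)]|.
    apply: eq_card => i; rewrite inE; apply/idP/imsetP => [iZ|[j _ ->] //=].
    by exists (Ordinal iZ) => //; apply: val_inj.
  by rewrite card_imset ?card_ord // => i j /(congr1 val) /= /val_inj.
rewrite -[RHS](sum_valid_det0 (@coinv_prod_lin n) (@coinv_high_deg n) phi_inj n0 size_h
  h_sorted h_gt0 h_lt h_lt_a a0 sn hM cZ).
have dJE (J : {set 'I_n}) : dJ J = (\sum_(l < s) nth 0%N (js J) (r + l))%:Z - M%:Z.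
  rewrite /dJ /M sumrB.
  by congr (_ - _); rewrite -natz natr_sum; apply: eq_bigr => l _; rewrite natz.
apply: eq_big => [J|J /and4P[Jn cJ tJ dJ0]].
  by rewrite /valid_set -kE dJE subr_ge0 lez_nat.
have vJ : valid_set r s M h J.
  by rewrite /valid_set -kE cJ Jn tJ /=; move: dJ0; rewrite dJE subr_ge0 lez_nat.
pose g := tail_fun r s n0 J; pose m := (\sum_l g l)%N.
have jsE : js J = h ++ tail_values g by exact: (sorted_elems_valid n0 vJ).
have tailE (l : 'I_s) : nth 0%N (js J) (r + l) = g l.
  rewrite jsE nth_cat size_h ltnNge leq_addr /= addKn.
  by rewrite (nth_map l) ?size_enum_ord // nth_ord_enum.
have mM : (M <= m)%N by exact: (sum_tail_fun n0 size_h vJ).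
have dE : dJ J = (m - M)%N.
  by rewrite dJE -subzn // /m; congr (Posz _ - _); apply: eq_bigr => l _; exact: tailE.
have detE : to_coinv n (\det (Mx J)) = exponent_det (@coinvX n) h phi g.
  rewrite -det_map_mx; congr (\det _); apply/matrixP => l c; rewrite [LHS]mxE [in LHS]mxE rmorphXn.
  case: (split_ordP l) => l' ->; rewrite ?col_mxEu ?col_mxEd !mxE -/(coinvX _); congr (_ ^+ _).
    by rewrite /= jsE nth_cat size_h ltn_ord.
  by rewrite /= tailE.
have cfE : to_coinv n (cf J)%:MP =
    (-1) ^+ (m - M) * 'C(m - M + u, u)%:R * rising_det (coinv n) g.
  rewrite /cf dE absz_nat !rmorphM /= (@to_coinv_Delta_num _ s _ g); first last.
  - by move=> l; rewrite nth_drop tailE.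
  - by rewrite size_drop js_size // subKn.
  by rewrite !rmorphXn !rmorphN1 !rmorph_nat mulrAC.
rewrite to_coinv_scale (rmorphM (to_coinv n) (ef J)) detE cfE /tail_coef -/g -/m /ef dE -leq_subLR.
case: leqP => mn.
  rewrite subzn // to_coinv_esym_first -/Z.
  by rewrite -!mulrA; congr (_ * (_ * _)); rewrite mulrCA.
(* Here [d > n - s], and [esym_first] vanishes at a negative index. *)
have : (n - s)%N%:Z - (m - M)%N%:Z < 0 by rewrite subr_lt0 ltz_nat.
by case: (_ - _ : int) => // z _; rewrite rmorph0 mul0r mulr0 mul0r.
Qed.
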